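(* Let $G$ be a primitive strongly regular graph with adjacency cosine $\alpha$ and non-adjacency cosine $\beta$, and let $H$ be an $(\alpha,\beta')$-graph for some real $\beta'$. Let $\varphi$ be a homomorphism from $G$ to $H$. Then: (1) if $\beta>\beta'$, then $\varphi$ is a coloring; (2) if $\beta=\beta'$, then $\varphi$ is either a coloring or an isomorphism from $G$ to an induced subgraph of $H$ (i.e. $\varphi$ is injective and $u\sim v\iff\varphi(u)\sim\varphi(v)$).
   Context: A graph is strongly regular with parameters $(n,k,\lambda,\mu)$ if it has $n$ vertices, is $k$-regular, every pair of adjacent vertices has $\lambda$ common neighbors and every pair of distinct non-adjacent vertices has $\mu$ common neighbors; it is primitive if neither it nor its complement is disconnected. For such a graph with least adjacency eigenvalue $\tau$, the adjacency cosine is $\tau/k$ and the non-adjacency cosine is $(-\tau-1)/(n-k-1)$. For a graph $H$ and real $t\ge 2$, a strict vector $t$-coloring of $H$ is an assignment of unit vectors $p_x$ to the vertices $x$ of $H$ with $p_x^Tp_y=-1/(t-1)$ whenever $x\sim y$; the strict vector chromatic number of a non-empty graph is the minimum $t\ge2$ for which a strict vector $t$-coloring exists, and a strict vector coloring achieving this minimum is optimal. For reals $\alpha,\beta$, a graph $H$ with adjacency matrix $A_H$ and complement adjacency matrix $\overline{A}_H = J-I-A_H$ is an $(\alpha,\beta)$-graph if $I+\alpha A_H+\beta\overline{A}_H$ is the Gram matrix of an optimal strict vector coloring of $H$. A homomorphism from $G$ to $H$ is a map $\varphi:V(G)\to V(H)$ with $\varphi(u)\sim\varphi(v)$ whenever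 $u\sim v$; it is a coloring if its image induces a clique of $H$. *)

(* Defs.v *)
From HB Require Import structures.
From mathcomp Require Import all_boot all_order all_algebra.
From mathcomp Require Import reals.
Set Implicit Arguments.
Unset Strict Implicit.
Unset Printing Implicit Defensive.
Import Order.TTheory GRing.Theory Num.Theory.
Local Open Scope ring_scope.

Record sgraph (V : finType) := SGraph {
  adj :> rel V;
  adj_sym : symmetric adj;
  adj_irr : irreflexive adj }.

Section Graphs.
Variable V : finType.
Implicit Type G : sgraph V.

Definition compl_rel G : rel V := fun x y => (x != y) && ~~ adj G x y.

Lemma compl_sym G : symmetric (compl_rel G).
Proof. by move=> x y; rewrite /compl_rel eq_sym adj_sym. Qed.

Lemma compl_irr G : irreflexive (compl_rel G).
Proof. by move=> x; rewrite /compl_rel eqxx. Qed.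

Definition compl_graph G : sgraph V := SGraph (compl_sym G) (compl_irr G).

Definition neighbors G (x : V) : {set V} := [set y | adj G x y].

Definition strongly_regular G (n k lambda mu : nat) : Prop :=
  [/\ #|V| = n,
      forall x, #|neighbors G x| = k,
      forall x y, adj G x y -> #|neighbors G x :&: neighbors G y| = lambda
    & forall x y, x != y -> ~~ adj G x y ->
        #|neighbors G x :&: neighbors G y| = mu].

Definition connected_graph G : Prop := forall x y, connect (adj G) x y.

Definition primitive G : Prop :=
  connected_graph G /\ connected_graph (compl_graph G).

(* "Non-empty" for colorings means having at least one edge. *)
Definition nonempty_graph G : Prop := exists x y, adj G x y.

Definition is_clique G (S : {set V}) : Prop :=
  forall x y, x \in S -> y \in S -> x != y -> adj G x y.

End Graphs.

Section RealGraphs.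
Variables (R : realType) (V : finType).
Implicit Type G : sgraph V.

(* Matrices indexed by V use the enumeration enum_val : 'I_#|V| -> V. *)
Definition adjmx G : 'M[R]_#|V| :=
  \matrix_(i, j) (adj G (enum_val i) (enum_val j))%:R.

Definition compl_adjmx G : 'M[R]_#|V| := const_mx 1 - 1%:M - adjmx G.

Definition least_eigenvalue (m : nat) (A : 'M[R]_m) (tau : R) : Prop :=
  eigenvalue A tau /\ forall a, eigenvalue A a -> tau <= a.

Definition dotv (d : nat) (p q : 'cV[R]_d) : R := (p^T *m q) 0 0.

Definition strict_vector_coloring G (t : R) (d : nat) (p : V -> 'cV[R]_d)
    : Prop :=
  [/\ 2 <= t,
      forall x, dotv (p x) (p x) = 1
    & forall x y, adj G x y -> dotv (p x) (p y) = - 1 / (t - 1)].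

Definition strict_vector_colorable G (t : R) : Prop :=
  exists (d : nat) (p : V -> 'cV[R]_d), strict_vector_coloring G t p.

Definition strict_vector_chromatic_number G (t : R) : Prop :=
  [/\ nonempty_graph G,
      strict_vector_colorable G t
    & forall s, strict_vector_colorable G s -> t <= s].

Definition optimal_strict_vector_coloring G (d : nat) (p : V -> 'cV[R]_d)
    : Prop :=
  exists t, strict_vector_chromatic_number G t /\ strict_vector_coloring G t p.

Definition gram_mx (d : nat) (p : V -> 'cV[R]_d) : 'M[R]_#|V| :=
  \matrix_(i, j) dotv (p (enum_val i)) (p (enum_val j)).

Definition ab_graph (alpha beta : R) G : Prop :=
  exists (d : nat) (p : V -> 'cV[R]_d),
    optimal_strict_vector_coloring G p /\
    1%:M + alpha *: adjmx G + beta *: compl_adjmx G = gram_mx p.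

End RealGraphs.

Definition adjacency_cosine (R : realType) (k : nat) (tau : R) : R :=
  tau / k%:R.

Definition nonadjacency_cosine (R : realType) (n k : nat) (tau : R) : R :=
  (- tau - 1) / (n%:R - k%:R - 1).

Section Homomorphisms.
Variables (V W : finType) (G : sgraph V) (H : sgraph W) (phi : V -> W).

Definition homomorphism : Prop :=
  forall u v, adj G u v -> adj H (phi u) (phi v).

Definition is_coloring : Prop := is_clique H (phi @: [set: V]).

Definition induced_embedding : Prop :=
  injective phi /\ forall u v, adj G u v <-> adj H (phi u) (phi v).

End Homomorphisms.

(* Main.v *)
(** Let X be the Gram matrix of the vectors of H pulled back along phi. It has
    1 on the diagonal and tau / k on the edges of G, so it is orthogonal to the
    positive semidefinite matrix A - tau I and hence killed by it. If u, v are
    nonadjacent and phi u, phi v are distinct and nonadjacent, then reading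
    A X = tau X at (u, v) is impossible when beta' < beta, and when
    beta' = beta it propagates the property from v to every neighbour of v
    that is not adjacent to u. As the second subconstituents of a primitive
    strongly regular graph are connected, and so is its complement, the
    property holds for all nonadjacent pairs (an embedding) or none
    (a coloring). *)
Require Import Defs.
From mathcomp Require Import all_boot all_order all_algebra.
From mathcomp Require Import reals.
From mathcomp Require Import ring lra.
Import Order.TTheory GRing.Theory Num.Theory.
Local Open Scope ring_scope.
Set Implicit Arguments.
Unset Strict Implicit.

(** * Connectivity *)

Lemma connected_closed (V : finType) (G : sgraph V) (P : pred V) (x y : V) :
  connected_graph G -> (forall u v, P u -> adj G u v -> P v) -> P x -> P y.
Proof.
move=> Gc clP; have /connectP[s] := Gc x y.
elim: s x => [|z s IHs] x /= => [_ -> //|/andP[xz zs] ys Px].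
exact: IHs zs ys (clP _ _ Px xz).
Qed.

Lemma connected_has_edge (V : finType) (G : sgraph V) (x y : V) :
  connected_graph G -> x != y -> exists z, adj G x z.
Proof.
move=> Gc xy; case: (pickP (adj G x)) => [z xz|x0]; first by exists z.
have := @connected_closed _ G (pred1 x) x y Gc.
rewrite /= eqxx eq_sym (negPf xy) => H.
by have: false by apply: H => // u v /eqP->; rewrite x0.
Qed.

(** * Second subconstituents of strongly regular graphs *)

Section StronglyRegular.
Variables (V : finType) (G : sgraph V) (n k lambda mu : nat).
Hypothesis Gsrg : strongly_regular G n k lambda mu.

(* A proper nonempty union C of components would force all vertices not
   adjacent to u to have the same common neighbours S with u, and S would be
   closed in the complement. *)
Lemma second_subconstituent_connected (u : V) (C : pred V) :
    primitive G ->
    (forall v, C v -> compl_rel G u v) ->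
    (forall v w, C v -> adj G v w -> compl_rel G u w -> C w) ->
  forall v w, C v -> compl_rel G u w -> C w.
Proof.
move=> [Gc Gcc] Csub Ccl v w Cv uw; apply/negPn/negP => nCw.
have [_ _ _ hmu] := Gsrg.
pose S z := neighbors G u :&: neighbors G z.
have cardS z : compl_rel G u z -> #|S z| = mu by case/andP=> uz nuz; apply: hmu.
have eqS c d : C c -> compl_rel G u d -> ~~ C d -> S c = S d.
  move=> Cc ud nCd; have uc := Csub _ Cc.
  have ncd : ~~ adj G c d by apply: contra nCd => cd; apply: Ccl Cc cd ud.
  have c_d : c != d by apply: contraNneq nCd => <-.
  pose T := neighbors G c :&: neighbors G d.
  have cT : #|T| = mu by apply: hmu.
  (* A common neighbour of [c] and [d] outside N(u) would lie in [C] and pull [d] into [C]. *)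
  have TN : T \subset neighbors G u.
    apply/subsetP => z; rewrite !inE => /andP[cz dz].
    apply/negPn/negP => nuz.
    have uz : compl_rel G u z.
      rewrite /compl_rel nuz andbT; apply: contraTneq cz => <-.
      by rewrite adj_sym; case/andP: uc.
    have Cz := Ccl _ _ Cc cz uz.
    by case/negP: nCd; apply: Ccl Cz _ ud; rewrite adj_sym.
  have TS e : e \in [:: c; d] -> T = S e.
    move=> e_cd; apply/eqP; rewrite eqEcard cT cardS ?andbT ?leqnn.
      rewrite subsetI TN /T /=; move: e_cd.
      by rewrite !inE => /orP[]/eqP->; rewrite ?subsetIl ?subsetIr.
    by move: e_cd; rewrite !inE => /orP[]/eqP->.
  by rewrite -(TS c) ?(TS d) ?inE ?eqxx ?orbT.
have SE z : compl_rel G u z -> S z = S v.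
  have Svw := eqS _ _ Cv uw nCw.
  (* A vertex inside [C] is compared with [w], one outside [C] with [v]. *)
  move=> uz; case Cz: (C z); last by apply/esym/eqS; rewrite ?Cz.
  by rewrite Svw; apply: eqS.
have Sadj s z : s \in S v -> compl_rel G u z -> adj G s z.
  by move=> sS uz; move: sS; rewrite -(SE z uz) !inE [adj G s z]adj_sym; case/andP.
have uv := Csub _ Cv.
have Sadju s z : s \in S v -> z \notin S v -> adj G s z.
  move=> sS zS; case: (boolP (compl_rel G u z)) => [uz|]; first exact: Sadj.
  have us : adj G u s by move: sS; rewrite !inE; case/andP.
  rewrite /compl_rel negb_and negbK => /orP[/eqP<-|]; first by rewrite adj_sym.
  rewrite negbK => uz; apply/negPn/negP => nsz.
  have zs : z != s by apply: contraNneq zS => ->.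
  have vz : ~~ adj G v z by move: zS; rewrite !inE uz.
  have v_z : v != z by apply: contraTneq uz => <-; case/andP: uv.
  (* A common neighbour [t] of [v] and [z] outside N(u) would put [z] in [S t = S v]. So both sets,
     of size [mu], coincide, and [s] is adjacent to [z]. *)
  have : S v = neighbors G v :&: neighbors G z.
    apply/eqP; rewrite eq_sym eqEcard cardS // hmu // leqnn andbT.
    rewrite subsetI subsetIl andbT; apply/subsetP => t; rewrite !inE => /andP[vt zt].
    apply/negPn/negP => nut.
    have ut : compl_rel G u t.
      rewrite /compl_rel nut andbT; apply: contraTneq vt => <-.
      by rewrite adj_sym; case/andP: uv.
    by move: zS; rewrite -(SE t ut) !inE uz adj_sym zt.
  move=> /setP/(_ s); rewrite sS => /esym; rewrite !inE => /andP[_].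
  by rewrite adj_sym (negPf nsz).
(* If [S v] were empty, [u] and its neighbours would form a component of [G] missing [v]. *)
have [s sS] : exists s, s \in S v.
  apply/set0Pn/negP => /eqP S0.
  pose P x := (x == u) || adj G u x.
  have : P v.
    apply: (@connected_closed _ G P u v Gc); last by rewrite /P eqxx.
    move=> x y /orP[/eqP-> uy|ux xy]; first by rewrite /P uy orbT.
    apply/negPn/negP; rewrite /P negb_or eq_sym => uy.
    by have := in_set0 x; rewrite -S0 -(SE y uy) !inE ux adj_sym xy.
  by rewrite /P eq_sym; case/andP: uv => /negPf-> /negPf->.
have : u \in S v.
  apply: (@connected_closed _ (compl_graph G) (mem (S v)) s u Gcc) => //.
  move=> x y xS /andP[xy nxy]; apply/negPn/negP => yS.
  by rewrite (Sadju x y) in nxy.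
by rewrite !inE adj_irr.
Qed.

(** * The adjacency operator and its spectrum *)

Section AdjacencyOperator.
Variable R : realType.
Implicit Type f g : V -> R.

Definition adj_sum f v : R := \sum_(w | adj G v w) f w.

Lemma sum_adj_sum f g : \sum_v f v * adj_sum g v = \sum_v adj_sum f v * g v.
Proof.
under eq_bigr do rewrite mulr_sumr.
rewrite (exchange_big_dep predT) //=; apply: eq_bigr => v _.
rewrite mulr_suml; apply: eq_big => // w; exact: adj_sym.
Qed.

Lemma adj_sum_const (c : R) v : adj_sum (fun=> c) v = k%:R * c.
Proof.
have [_ hk _ _] := Gsrg.
rewrite /adj_sum sumr_const -[in k%:R](hk v) mulr_natl; congr (_ *+ _).
by apply: eq_card => w; rewrite !inE.
Qed.

Lemma sum_of_adj_sum f : \sum_v adj_sum f v = k%:R * \sum_v f v.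
Proof.
have := sum_adj_sum (fun=> 1) f; under eq_bigr do rewrite mul1r.
by move=> ->; rewrite mulr_sumr; apply: eq_bigr => v _; rewrite adj_sum_const mulr1.
Qed.

Lemma eq_adj_sum f g : f =1 g -> adj_sum f =1 adj_sum g.
Proof. by move=> fg v; apply: eq_bigr. Qed.

Lemma adj_sum_linear (a b : R) f g v :
  adj_sum (fun w => a * f w + b * g w) v = a * adj_sum f v + b * adj_sum g v.
Proof. by rewrite /adj_sum big_split /= -!mulr_sumr. Qed.

(** Walks of length two between [v] and [w] number [k], [lambda] or [mu]; this is A^2 = k I + lambda
    A + mu (J - I - A) applied to [f]. *)
Lemma adj_sum_sq f v : adj_sum (adj_sum f) v =
  (k%:R - mu%:R) * f v + (lambda%:R - mu%:R) * adj_sum f v + mu%:R * \sum_w f w.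
Proof.
have [_ hk hl hm] := Gsrg.
rewrite /adj_sum (exchange_big_dep predT) //=.
have -> : f v = \sum_w (w == v)%:R * f w.
  rewrite (bigD1 v) //= eqxx mul1r big1 ?addr0 // => w /negPf->.
  by rewrite mul0r.
have -> : \sum_(w | adj G v w) f w = \sum_w (adj G v w)%:R * f w.
  rewrite big_mkcond; apply: eq_bigr => w _.
  by case: (adj G v w); rewrite ?mul1r ?mul0r.
rewrite !mulr_sumr -!big_split; apply: eq_bigr => w _ /=.
rewrite sumr_const -mulr_natl.
have -> : #|[pred i | adj G v i & adj G i w]| = #|neighbors G v :&: neighbors G w|.
  by apply: eq_card => z; rewrite !inE [adj G w z]adj_sym.
have [->|wv] := eqVneq w v; first by rewrite setIid hk adj_irr /=; ring.
case: (boolP (adj G v w)) => [vw|nvw]; first by rewrite hl //=; ring.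
by rewrite hm 1?eq_sym //=; ring.
Qed.

(** [eigenvalue] uses row vectors; symmetry of [adj] turns their action into [adj_sum]. *)
Lemma adj_eigenvalueP (a : R) :
  eigenvalue (adjmx R G) a <->
  exists2 f : V -> R, (forall v, adj_sum f v = a * f v) & exists v, f v != 0.
Proof.
have mulE (r : 'rV[R]_#|V|) v : (r *m adjmx R G) 0 (enum_rank v) =
    adj_sum (fun w => r 0 (enum_rank w)) v.
  rewrite mxE (reindex (@enum_rank V)) /=; last exact: onW_bij (@enum_rank_bij V).
  rewrite /adj_sum [RHS]big_mkcond; apply: eq_bigr => w _.
  rewrite mxE !enum_rankK [adj G w v]adj_sym.
  by case: (adj G v w); rewrite ?mulr1 ?mulr0.
split=> [/eigenvalueP[r rA r0]|[f fA [v fv]]].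
  exists (fun w => r 0 (enum_rank w)) => [v|]; first by rewrite -mulE rA mxE.
  have [j rj] := rV0Pn _ r0.
  by exists (enum_val j); rewrite enum_valK.
apply/eigenvalueP; exists (\row_j f (enum_val j)).
  apply/rowP => j; rewrite -[j]enum_valK mulE [RHS]mxE mxE enum_rankK -fA.
  by apply: eq_adj_sum => w; rewrite mxE enum_rankK.
apply/rV0Pn; exists (enum_rank v); by rewrite mxE enum_rankK.
Qed.

Lemma srg_mu_le (x y : V) : compl_rel G x y -> (mu <= k)%N.
Proof.
have [_ hk _ hm] := Gsrg.
move=> /andP[xy nxy]; rewrite -(hm x y) // -(hk x).
exact/subset_leq_card/subsetIl.
Qed.

Lemma srg_lambda_lt (x y : V) : adj G x y -> (lambda < k)%N.
Proof.
have [_ hk hl _] := Gsrg.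
move=> xy; rewrite -(hl x y) // -(hk x); apply/proper_card.
rewrite properE subsetIl /=; apply/subsetPn; exists y; rewrite !inE ?xy //.
by rewrite adj_irr.
Qed.

(* -1 lies between the roots of X^2 - (lambda - mu) X - (k - mu), and the
   smaller root is an eigenvalue: (A - theta I)(e_x - e_y) is an eigenvector. *)
Lemma srg_least_eigenvalue (x y x' y' : V) (tau : R) :
    adj G x y -> compl_rel G x' y' -> least_eigenvalue (adjmx R G) tau ->
  tau <= -1 /\ tau ^+ 2 = (lambda%:R - mu%:R) * tau + (k%:R - mu%:R).
Proof.
move=> xy xy' [/adj_eigenvalueP[f fA [v fv]] tau_min].
have kmu : (mu%:R <= k%:R :> R) by rewrite ler_nat (srg_mu_le xy').
have kl : (lambda%:R + 1 <= k%:R :> R) by rewrite natr1 ler_nat (srg_lambda_lt xy).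
pose b : R := lambda%:R - mu%:R; pose c : R := k%:R - mu%:R.
pose s := Num.sqrt (b ^+ 2 + 4 * c).
have s2 : s ^+ 2 = b ^+ 2 + 4 * c.
  by rewrite sqr_sqrtr // addr_ge0 ?sqr_ge0 // mulr_ge0 // subr_ge0.
have s0 : 0 <= s by apply: sqrtr_ge0.
pose th := (b + s) / 2; pose t := (b - s) / 2.
have tht : th * t = - c by rewrite /th /t; field: s2.
have thD : th + t = b by rewrite /th /t; field.
have c0 : 0 <= c by rewrite subr_ge0.
have tth : t <= th by rewrite /th /t; lra.
have th0 : 0 <= th by nra.
have t1 : t <= -1.
  (* The quadratic takes the value 1 + lambda - k at -1, and the factor [- 1 - th] is negative. *)
  have : (- 1 - th) * (- 1 - t) <= 0.
    have -> : (- 1 - th) * (- 1 - t) = 1 + (th + t) + th * t by ring.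
    by rewrite tht thD /b /c; lra.
  nra.
have t_ev : eigenvalue (adjmx R G) t.
  pose g w : R := (w == x)%:R - (w == y)%:R.
  pose h w := 1 * adj_sum g w + (- th) * g w.
  have sumg : \sum_w g w = 0.
    rewrite sumrB; apply/eqP; rewrite subr_eq0; apply/eqP.
    have E z : \sum_w (w == z)%:R = 1 :> R.
      rewrite (bigD1 z) //= eqxx big1 ?addr0 // => w /negPf->.
      by [].
    by rewrite !E.
  apply/adj_eigenvalueP; exists h.
    move=> w; rewrite /h adj_sum_linear adj_sum_sq sumg -/b -/c -thD.
    by rewrite -[c]opprK -tht; ring.
  exists x; have -> : h x = - 1 - th.
    have -> : h x = adj_sum g x - th.
      have xny : (x == y) = false by apply: contraTF xy => /eqP->; rewrite adj_irr.
      by rewrite /h {2}/g eqxx xny /=; ring.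
    congr (_ - _); rewrite /adj_sum (bigD1 y) //= big1 => [|w /andP[xw /negPf wy]].
      rewrite /g eqxx addr0; have -> : (y == x) = false.
        by apply: contraTF xy => /eqP->; rewrite adj_irr.
      by rewrite /=; ring.
    rewrite /g wy; have -> : (w == x) = false.
      by apply: contraTF xw => /eqP->; rewrite adj_irr.
    by rewrite /=; ring.
  by apply/eqP; lra.
have tau1 : tau <= -1 by apply: le_trans t1; apply: tau_min.
split=> //.
(* Summing A f = tau f over all vertices gives k S = tau S with tau < 0 <= k, which removes the J
   term of A^2. *)
have S0 : \sum_w f w = 0.
  have : k%:R * \sum_w f w = tau * \sum_w f w.
    by rewrite -sum_of_adj_sum mulr_sumr; apply: eq_bigr.
  move/eqP; rewrite -subr_eq0 -mulrBl mulf_eq0 => /orP[|/eqP//].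
  by have := ler0n R k => k0 /eqP; lra.
have := adj_sum_sq f v; rewrite S0 mulr0 addr0.
rewrite (eq_adj_sum fA) fA.
have -> : adj_sum (fun w => tau * f w) v = tau * (tau * f v).
  by rewrite -fA /adj_sum mulr_sumr.
move=> E; apply: (mulIf fv); ring: E.
Qed.

(* With g = (A - tau) f, theta = lambda - mu - tau, S the sum of f and c the
   mean of g, one has
   n |g - c|^2 + (k - tau) (theta - tau) S^2 = n (theta - tau) <f, g>. *)
Lemma srg_quadratic_form (tau : R) f :
    tau < 0 -> (mu <= k)%N -> (0 < n)%N ->
    tau ^+ 2 = (lambda%:R - mu%:R) * tau + (k%:R - mu%:R) ->
  0 <= \sum_v f v * (adj_sum f v - tau * f v) /\
  (\sum_v f v * (adj_sum f v - tau * f v) = 0 ->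
   forall v, adj_sum f v = tau * f v).
Proof.
move=> tau0 muk n0 tauE; have [hn _ _ _] := Gsrg.
have kmu : (mu%:R <= k%:R :> R) by rewrite ler_nat.
have nR : (0 < n%:R :> R) by rewrite ltr0n.
pose th : R := lambda%:R - mu%:R - tau.
have tht : th * tau = mu%:R - k%:R by rewrite /th; ring: tauE.
have th0 : 0 <= th by nra.
have k0 := ler0n R k.
have /card_gt0P[v0 _] : (0 < #|V|)%N by rewrite hn.
have sum_cst (c : R) : \sum_(v : V) c = n%:R * c by rewrite sumr_const hn mulr_natl.
(* A^2 on the constant 1 evaluates at [k] the quadratic with roots [tau] and [th]. *)
have kth : (k%:R - tau) * (k%:R - th) = mu%:R * n%:R.
  have := adj_sum_sq (fun=> 1) v0.
  rewrite (eq_adj_sum (adj_sum_const 1)) !adj_sum_const sum_cst => E.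
  by rewrite /th; ring: E tauE.
pose g v := 1 * adj_sum f v + (- tau) * f v.
pose S := \sum_v f v; pose Q := \sum_v f v * g v.
have QE : \sum_v f v * (adj_sum f v - tau * f v) = Q.
  by apply: eq_bigr => v _; rewrite /g; ring.
rewrite QE.
(* This is (A - th)(A - tau) = mu J. *)
have gA v : adj_sum g v = th * g v + mu%:R * S.
  by rewrite /g adj_sum_linear adj_sum_sq -/S /th; ring: tauE.
have sumg : \sum_v g v = (k%:R - tau) * S.
  by rewrite /g big_split /= -!mulr_sumr sum_of_adj_sum -/S; ring.
have sumg2 : \sum_v g v ^+ 2 = (th - tau) * Q + mu%:R * S ^+ 2.
  transitivity (\sum_v g v * adj_sum f v - tau * \sum_v f v * g v).
    rewrite mulr_sumr -sumrB; apply: eq_bigr => v _; rewrite {2}/g /=.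
    by rewrite {1}/g /g; ring.
  rewrite sum_adj_sum -/Q.
  under eq_bigr do rewrite gA mulrDl.
  rewrite big_split /= -mulr_sumr -/S.
  under eq_bigr do rewrite -mulrA [g _ * _]mulrC.
  by rewrite -mulr_sumr -/Q; ring.
pose c := (k%:R - tau) * S / n%:R.
have nc : n%:R * c = (k%:R - tau) * S by rewrite /c mulrC divfK // gt_eqF.
have sumgc : n%:R * \sum_v (g v - c) ^+ 2 + (k%:R - tau) * (th - tau) * S ^+ 2
    = n%:R * (th - tau) * Q.
  have -> : \sum_v (g v - c) ^+ 2 =
      \sum_v g v ^+ 2 - 2 * c * \sum_v g v + n%:R * c ^+ 2.
    rewrite -sum_cst mulr_sumr -sumrB -big_split; apply: eq_bigr => v _ /=.
    ring.
  rewrite sumg2 sumg.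
  have -> : n%:R * ((th - tau) * Q + mu%:R * S ^+ 2 - 2 * c * ((k%:R - tau) * S)
                    + n%:R * c ^+ 2) =
      n%:R * (th - tau) * Q + (mu%:R * n%:R) * S ^+ 2
      - 2 * (n%:R * c) * ((k%:R - tau) * S) + (n%:R * c) ^+ 2.
    ring.
  by rewrite nc -kth; ring.
have G0 : 0 <= \sum_v (g v - c) ^+ 2 by apply: sumr_ge0 => v _; apply: sqr_ge0.
have S20 : 0 <= S ^+ 2 by apply: sqr_ge0.
have A0 : 0 <= n%:R * \sum_v (g v - c) ^+ 2 by rewrite mulr_ge0 ?ler0n.
have tht0 : 0 < th - tau by lra.
have B0 : 0 < (k%:R - tau) * (th - tau) by apply: mulr_gt0; lra.
have C0 : 0 <= (k%:R - tau) * (th - tau) * S ^+ 2 by rewrite mulr_ge0 // ltW.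
split=> [|Q0].
  rewrite -(pmulr_rge0 _ (mulr_gt0 nR tht0)) -sumgc; exact: addr_ge0.
move: sumgc; rewrite Q0 mulr0 => /eqP; rewrite paddr_eq0 // => /andP[].
rewrite mulf_eq0 (gt_eqF nR) => /eqP Gz.
rewrite mulf_eq0 (gt_eqF B0) sqrf_eq0 => /eqP Sz v.
have c0 : c = 0 by rewrite /c Sz mulr0 mul0r.
have : (g v - c) ^+ 2 == 0.
  have /psumr_eq0P/(_ Gz v isT)-> // : forall v, true -> 0 <= (g v - c) ^+ 2.
  by move=> w _; apply: sqr_ge0.
rewrite sqrf_eq0 c0 subr0 /g mul1r mulNr subr_eq0 => /eqP //.
Qed.

End AdjacencyOperator.
End StronglyRegular.

(** * Gram matrices and cosines *)

Lemma dotvE (R : realType) (d : nat) (p q : 'cV[R]_d) :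
  dotv p q = \sum_i p i 0 * q i 0.
Proof. by rewrite /dotv mxE; apply: eq_bigr => i _; rewrite mxE. Qed.

Lemma ab_gramE (R : realType) (W : finType) (H : sgraph W) (a b : R) d
    (p : W -> 'cV[R]_d) :
  1%:M + a *: adjmx R H + b *: compl_adjmx R H = gram_mx p ->
  forall x y, dotv (p x) (p y) =
    if x == y then 1 else if adj H x y then a else b.
Proof.
move=> /matrixP E x y; have := E (enum_rank x) (enum_rank y).
rewrite !mxE !enum_rankK (inj_eq enum_rank_inj) => <-.
have [->|xy] := eqVneq x y; first by rewrite adj_irr /=; ring.
by case: (adj H x y) => /=; ring.
Qed.

(* The Gram matrix of a vector coloring with cosine tau / k pairs to zero with
   the positive semidefinite A - tau I, so it is annihilated by it. *)
Lemma srg_coloring_eigen (R : realType) (V : finType) (G : sgraph V)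
    (n k lambda mu : nat) (tau : R) (d : nat) (q : V -> 'cV[R]_d) :
    strongly_regular G n k lambda mu ->
    tau < 0 -> (mu <= k)%N -> (0 < n)%N -> (0 < k)%N ->
    tau ^+ 2 = (lambda%:R - mu%:R) * tau + (k%:R - mu%:R) ->
    (forall v, dotv (q v) (q v) = 1) ->
    (forall v w, adj G v w -> dotv (q v) (q w) = tau / k%:R) ->
  forall u v, \sum_(w | adj G v w) dotv (q u) (q w) = tau * dotv (q u) (q v).
Proof.
move=> Gsrg tau0 muk n0 k0 tauE q1 qa u v.
pose f i w := q w i 0.
have QP i := srg_quadratic_form Gsrg (f i) tau0 muk n0 tauE.
(* Summed over the coordinates, the quadratic forms contribute k (tau / k) - tau = 0 at each
   vertex. *)
have sumQ : \sum_i \sum_v f i v * (adj_sum G (f i) v - tau * f i v) = 0.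
  rewrite exchange_big big1 //= => w _.
  transitivity (\sum_(z | adj G w z) dotv (q w) (q z) - tau * dotv (q w) (q w)).
    rewrite dotvE mulr_sumr.
    under [X in _ = X - _]eq_bigr do rewrite dotvE.
    rewrite exchange_big -sumrB; apply: eq_bigr => i _.
    by rewrite -mulr_sumr -/(adj_sum _ _ _) /f; ring.
  rewrite (eq_bigr (fun=> tau / k%:R)) => [|z wz]; last exact: qa.
  have := adj_sum_const Gsrg (tau / k%:R) w; rewrite /adj_sum => ->.
  by rewrite q1; field; rewrite pnatr_eq0 -lt0n.
have fA i : forall w, adj_sum G (f i) w = tau * f i w.
  apply: (proj2 (QP i)).
  by have /psumr_eq0P/(_ sumQ i isT) : forall i, true ->
    0 <= \sum_v f i v * (adj_sum G (f i) v - tau * f i v) by move=> j _; case: (QP j).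
under eq_bigr do rewrite dotvE.
rewrite exchange_big dotvE mulr_sumr; apply: eq_bigr => i _.
by rewrite -mulr_sumr -/(adj_sum G (f i) v) fA /f; ring.
Qed.

(** This is the entry of A E = tau E at a nonadjacent pair, where E has diagonal 1 and the two
    cosines off it. After clearing denominators it follows from [tauE] and the count of walks of
    length two. *)
Lemma srg_nonadjacency_identity (R : realType) (V : finType) (G : sgraph V)
    (n k lambda mu : nat) (tau : R) (x y : V) :
    strongly_regular G n k lambda mu -> compl_rel G x y -> (0 < k)%N ->
    tau ^+ 2 = (lambda%:R - mu%:R) * tau + (k%:R - mu%:R) ->
  mu%:R * adjacency_cosine k tau
    + (k%:R - mu%:R) * nonadjacency_cosine n k tau
  = tau * nonadjacency_cosine n k tau.
Proof.
move=> Gsrg xy k0 tauE; have [hn hk _ _] := Gsrg.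
have kR : (k%:R != 0 :> R) by rewrite pnatr_eq0 -lt0n.
have count : k%:R * k%:R =
    (k%:R - mu%:R) + (lambda%:R - mu%:R) * k%:R + mu%:R * n%:R :> R.
  have := @adj_sum_sq _ _ _ _ _ _ Gsrg R (fun=> 1) x.
  rewrite (eq_adj_sum _ (adj_sum_const Gsrg 1)) !(adj_sum_const Gsrg).
  by rewrite sumr_const hn !mulr1.
(* [x], [y] and the [k] neighbours of [x] are distinct, so the denominator n - k - 1 is nonzero. *)
have nk : (k.+1 < n)%N.
  rewrite -hn -(hk x) -cardsT; have : y \notin x |: neighbors G x.
    by rewrite !inE negb_or eq_sym.
  have xN : x \notin neighbors G x by rewrite inE adj_irr.
  move=> yN; have -> : #|neighbors G x|.+2 = #|y |: (x |: neighbors G x)|.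
    by rewrite !cardsU1 yN xN.
  exact/subset_leq_card/subsetT.
have nkR : (n%:R - k%:R - 1 != 0 :> R).
  by rewrite -addrA -opprD natr1 subr_eq0 eqr_nat gtn_eqF.
rewrite /adjacency_cosine /nonadjacency_cosine.
apply: (mulIf (mulf_neq0 kR nkR)).
have -> : (mu%:R * (tau / k%:R)
           + (k%:R - mu%:R) * ((- tau - 1) / (n%:R - k%:R - 1)))
          * (k%:R * (n%:R - k%:R - 1)) =
    mu%:R * tau * (n%:R - k%:R - 1)
    + (k%:R - mu%:R) * (- tau - 1) * k%:R.
  by field; apply/andP.
have -> : tau * ((- tau - 1) / (n%:R - k%:R - 1)) * (k%:R * (n%:R - k%:R - 1)) =
    - tau ^+ 2 * k%:R - tau * k%:R.
  by field.
rewrite tauE; ring: count.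
Qed.

(** * Propagation of kept nonedges *)

(** For a homomorphism, a coloring has no such pair, while an embedding has every nonadjacent pair
    of distinct vertices. *)
Definition kept_nonedge (V W : finType) (G : sgraph V) (H : sgraph W)
    (phi : V -> W) (u v : V) : bool :=
  compl_rel G u v && compl_rel H (phi u) (phi v).

(* A neighbour w of v has phi w != phi u, so every term of the sum of
   X u w - beta over neighbours w of v not adjacent to u is nonpositive, whereas
   the sum equals tau (beta' - beta) >= 0. *)
Lemma kept_nonedge_step (R : realType) (V W : finType)
    (G : sgraph V) (H : sgraph W) (n k lambda mu : nat)
    (tau alpha beta beta' : R) (phi : V -> W) (X : V -> V -> R) (u v : V) :
    strongly_regular G n k lambda mu -> homomorphism G H phi ->
    (forall x y, X x y = if phi x == phi y then 1
                         else if adj H (phi x) (phi y) then alpha else beta') ->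
    \sum_(w | adj G v w) X u w = tau * X u v ->
    mu%:R * alpha + (k%:R - mu%:R) * beta = tau * beta ->
    tau < 0 -> alpha < beta -> beta' <= beta -> kept_nonedge G H phi u v ->
  beta' = beta /\
  forall w, adj G v w -> compl_rel G u w -> kept_nonedge G H phi u w.
Proof.
move=> Gsrg hom XE sumX idt tau0 ab b'b /andP[uv Huv]; have [_ _ _ hm] := Gsrg.
case/andP: (uv) => u_v nuv; case/andP: (Huv) => phi_uv nHuv.
have sumXb : \sum_(w | adj G v w) (X u w - beta) = tau * beta' - k%:R * beta.
  rewrite sumrB sumX XE (negPf phi_uv) (negPf nHuv).
  by have := adj_sum_const Gsrg beta v; rewrite /adj_sum => ->.
have sum_common : \sum_(w | adj G v w && adj G u w) (X u w - beta) =
    mu%:R * (alpha - beta).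
  rewrite (eq_bigr (fun=> alpha - beta)) => [|w /andP[_ uw]].
    rewrite sumr_const mulr_natl -(hm u v) //; congr (_ *+ _).
    by apply: eq_card => w; rewrite !inE andbC.
  have Huw := hom _ _ uw; rewrite XE Huw.
  by have [e|//] := eqVneq (phi u) (phi w); rewrite e adj_irr in Huw.
(* Otherwise the edge from [v] to [w] would make [phi u] and [phi v] adjacent. *)
have phi_uw w : adj G v w -> phi u != phi w.
  move=> vw; apply: contraNneq nHuv => ->; rewrite adj_sym; exact: hom.
have term_le0 w : adj G v w && ~~ adj G u w -> 0 <= beta - X u w.
  by case/andP=> vw _; rewrite XE (negPf (phi_uw w vw)); case: ifP => _; lra.
(* Removing the common neighbours from the total leaves tau beta' - (mu alpha + (k - mu) beta), and
   [idt] rewrites the bracket as tau beta. *)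
have sum_rest : \sum_(w | adj G v w && ~~ adj G u w) (beta - X u w) =
    tau * (beta - beta').
  have := sumXb; rewrite (bigID (adj G u)) /= sum_common => E.
  have -> : \sum_(w | adj G v w && ~~ adj G u w) (beta - X u w) =
      - \sum_(w | adj G v w && ~~ adj G u w) (X u w - beta).
    by rewrite -sumrN; apply: eq_bigr => w _; rewrite opprB.
  by lra.
have bb' : beta' = beta.
  have : 0 <= tau * (beta - beta') by rewrite -sum_rest; apply: sumr_ge0.
  by rewrite nmulr_rge0 // => ?; lra.
split=> // w vw uw; rewrite /kept_nonedge uw /compl_rel phi_uw //=.
apply/negP => Huw; case/andP: uw => _ nuw.
(* In the equality case every term vanishes, but adjacent images would give beta - alpha > 0. *)
have sum0 : \sum_(z | adj G v z && ~~ adj G u z) (beta - X u z) = 0.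
  by rewrite sum_rest bb' subrr mulr0.
have : beta - X u w = 0 by apply: (psumr_eq0P term_le0 sum0); rewrite vw.
by rewrite XE (negPf (phi_uw w vw)) Huw; lra.
Qed.

(** * Coloring or embedding *)

Unset Implicit Arguments.

Theorem theorem6p1 (R : realType) (V W : finType)
    (G : sgraph V) (H : sgraph W)
    (n k lambda mu : nat) (tau alpha beta beta' : R) (phi : V -> W)
    (Gsrg : strongly_regular G n k lambda mu)
    (Gprim : primitive G)
    (Gtau : least_eigenvalue (adjmx R G) tau)
    (def_alpha : alpha = adjacency_cosine k tau)
    (def_beta : beta = nonadjacency_cosine n k tau)
    (Hab : ab_graph alpha beta' H)
    (phi_hom : homomorphism G H phi) :
  (beta' < beta -> is_coloring H phi) /\
  (beta = beta' -> is_coloring H phi \/ induced_embedding G H phi).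
Proof.
pose K := kept_nonedge G H phi.
have no_kept_coloring : (forall u v, ~~ K u v) -> is_coloring H phi.
  move=> noK _ _ /imsetP[u _ ->] /imsetP[v _ ->] uv.
  case: (boolP (adj G u v)) => [|nuv]; first exact: phi_hom.
  have := noK u v; rewrite /K /kept_nonedge /compl_rel uv nuv andbT /=.
  have -> : u != v by apply: contraNneq uv => ->.
  by rewrite negbK.
(* With at most one vertex [phi] is trivially a coloring; otherwise primitivity gives both an edge
   and a nonedge at [x]. *)
case: (pickP [pred xy : V * V | xy.1 != xy.2]) => [[x y] /= x_y|V1]; last first.
  have noK u v : ~~ K u v.
    by rewrite /K /kept_nonedge /compl_rel; have /= -> := V1 (u, v).
  by split=> [|_]; [move=> _|left]; apply: no_kept_coloring.
have [Gc Gcc] := Gprim.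
have [z xz] := connected_has_edge Gc x_y.
have [z' xz'] := connected_has_edge Gcc x_y.
have [tau1 tauE] := srg_least_eigenvalue Gsrg xz xz' Gtau.
have tau0 : tau < 0 by lra.
have muk := srg_mu_le Gsrg xz'.
have k0 : (0 < k)%N := leq_ltn_trans (leq0n _) (srg_lambda_lt Gsrg xz).
have n0 : (0 < n)%N by have [<- _ _ _] := Gsrg; apply/card_gt0P; exists x.
have kR : (0 < k%:R :> R) by rewrite ltr0n.
have idt := srg_nonadjacency_identity Gsrg xz' k0 tauE.
rewrite -def_alpha -def_beta in idt.
have alpha0 : alpha < 0.
  by rewrite def_alpha /adjacency_cosine pmulr_llt0 ?invr_gt0.
have ab : alpha < beta.
  have mukR : (mu%:R <= k%:R :> R) by rewrite ler_nat.
  have mu0 := ler0n R mu.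
  (* Solving [idt] for beta shows beta >= 0 > alpha. *)
  have bE : (k%:R - mu%:R - tau) * beta = - (mu%:R * alpha) by lra.
  apply: (lt_le_trans alpha0); rewrite -(@pmulr_rge0 _ (k%:R - mu%:R - tau)); last lra.
  by rewrite bE oppr_ge0 mulr_ge0_le0 // ltW.
have [d [p [_ /ab_gramE pE]]] := Hab.
have sumX : forall u v, \sum_(w | adj G v w) dotv (p (phi u)) (p (phi w)) =
    tau * dotv (p (phi u)) (p (phi v)).
  apply: (srg_coloring_eigen (q := p \o phi) Gsrg) => // [v|v w vw] /=.
    by rewrite pE eqxx.
  have Hvw := phi_hom _ _ vw; rewrite pE Hvw -/(adjacency_cosine k tau) -def_alpha.
  by case: eqP => // e; rewrite e adj_irr in Hvw.
have step b'b u v := kept_nonedge_step Gsrg phi_hom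
  (fun x y => pE (phi x) (phi y)) (sumX u v) idt tau0 ab b'b.
split=> [b'b|bb'].
  apply: no_kept_coloring => u v; apply/negP => Kuv.
  have [e _] := step (ltW b'b) u v Kuv.
  by rewrite e ltxx in b'b.
have {}step u v w : K u v -> adj G v w -> compl_rel G u w -> K u w.
  have b'b : beta' <= beta by rewrite bb'.
  by move=> Kuv; have [_] := step b'b u v Kuv; apply.
have Kfull u v w : K u v -> compl_rel G u w -> K u w.
  apply: (second_subconstituent_connected Gsrg (C := K u) Gprim).
    by move=> {}v /andP[].
  by move=> {}v {}w; apply: step.
have Ksym u v : K u v -> K v u.
  by case/andP=> ? ?; apply/andP; split; rewrite compl_sym.
case: (pickP (fun uv : V * V => K uv.1 uv.2)) => [[u v] /= Kuv|noK]; last first.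
  by left; apply: no_kept_coloring => u v; have /= -> := noK (u, v).
have Kall a b : compl_rel G a b -> K a b.
  pose P e := [exists c, K e c].
  suff /existsP[c Kac] : P a by apply: Kfull Kac.
  (* Being in some kept pair passes along a complement edge from [e] to [f]: [Kfull] gives [K e f],
     and symmetry gives [K f e]. *)
  apply: (@connected_closed _ _ P u a Gcc).
    move=> e f /existsP[c Kec] ef; apply/existsP; exists e.
    exact/Ksym/(Kfull _ _ _ Kec).
  by apply/existsP; exists v.
right; split=> [a b ab'|a b].
  apply/eqP/negPn/negP => a_b.
  case: (boolP (adj G a b)) => [/phi_hom|nab]; first by rewrite ab' adj_irr.
  have /andP[_ /andP[]] : K a b by apply: Kall; rewrite /compl_rel a_b.
  by rewrite ab' eqxx.
split=> [|Hab']; first exact: phi_hom.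
apply/negPn/negP => nab.
have /andP[_ /andP[_]] : K a b.
  apply: Kall; rewrite /compl_rel nab andbT.
  by apply: contraTneq Hab' => ->; rewrite adj_irr.
by rewrite Hab'.
Qed.
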